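(* Let $K$ be a field, let $G$ be a connected graph on the vertex set $[n]=\{1,\ldots,n\}$, and let $\mathcal{J}_G$ be the binomial edge ideal of $G$ in $R=K[x_1,\ldots,x_n,y_1,\ldots,y_n]$. If $R/\mathcal{J}_G$ is Cohen-Macaulay, then either $\tau(G)=\frac{1}{2}$ or $G$ is the complete graph.
   Context: All graphs are simple and undirected. For a graph $G$ on $[n]$, the binomial edge ideal is $\mathcal{J}_G=(x_iy_j-x_jy_i : \{i,j\} \text{ an edge of } G)\subseteq R$, where $R$ is a polynomial ring in $2n$ variables over the field $K$. For $S\subseteq [n]$, $G\setminus S$ is the induced subgraph on $[n]\setminus S$, and $c(S)$ is the number of connected components of $G\setminus S$. A connected graph $G$ is $t$-tough if $t\cdot c(S)\leq |S|$ for every $S\neq\varnothing$ with $c(S)\geq 2$. The toughness $\tau(G)$ is the maximum $t$ for which $G$ is $t$-tough; for $G$ not complete, $\tau(G)=\min\{|S|/c(S) : S\subseteq[n],\ c(S)\geq 2\}$, and $\tau(G)=\infty$ if $G$ is complete. *)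

(* Defs.v *)
(* MathComp + multinomials; classical logic through [mathcomp.classical.boolp]. *)
From HB Require Import structures.
From mathcomp Require Import all_boot all_order all_algebra.
(* [mpoly] has to be imported before [constructive_ereal]: the other order makes
   their notations clash. *)
From mathcomp Require Import mpoly.
From mathcomp Require Import boolp constructive_ereal.

Set Implicit Arguments.
Unset Strict Implicit.
Unset Printing Implicit Defensive.

Import Order.TTheory GRing.Theory Num.Theory.
Local Open Scope ring_scope.

Section CohenMacaulay.
Variable A : comNzRingType.

(* Ideals are boolean predicates, as in [ring_quotient]; thanks to [asbool] this
   covers all subsets of A.  Beware that [idealr_closed] includes properness. *)

Definition ideal_gen (s : seq A) : {pred A} :=
  fun a => `[< exists c : 'I_(size s) -> A, a = \sum_i c i * s`_i >].

(* The unit ideal is left out, being generated by 1 anyway. *)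
Definition noetherian : Prop :=
  forall I : {pred A}, idealr_closed I -> exists s : seq A, I =i ideal_gen s.

Definition prime_ideal (P : {pred A}) : Prop :=
  idealr_closed P /\ prime_idealr_closed P.

Definition maximal_ideal (M : {pred A}) : Prop :=
  idealr_closed M /\
  forall I : {pred A}, idealr_closed I -> {subset M <= I} -> {subset I <= M}.

Definition regular_seq (s : seq A) : Prop :=
  1 \notin ideal_gen s /\
  forall i, (i < size s)%N -> forall a,
    s`_i * a \in ideal_gen (take i s) -> a \in ideal_gen (take i s).

(* depth(I, A), also called the grade of I. *)
Definition has_depth (I : {pred A}) (d : nat) : Prop :=
  (exists s, [/\ regular_seq s, {subset s <= I} & size s = d]) /\
  (forall s, regular_seq s -> {subset s <= I} -> (size s <= d)%N).

(* Q 0, ..., Q d is a strictly descending chain of primes starting from P;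
   the values of Q beyond d are irrelevant. *)
Definition prime_chain_from (P : {pred A}) (d : nat) (Q : nat -> {pred A}) : Prop :=
  [/\ Q 0%N =i P,
      forall i, (i <= d)%N -> prime_ideal (Q i)
    & forall i, (i < d)%N ->
        {subset Q i.+1 <= Q i} /\ ~ {subset Q i <= Q i.+1}].

(* codim P (the height of P), i.e. the Krull dimension of A_P. *)
Definition has_codim (P : {pred A}) (d : nat) : Prop :=
  (exists Q, prime_chain_from P d Q) /\
  (forall m Q, prime_chain_from P m Q -> (m <= d)%N).

(* D. Eisenbud, Commutative Algebra, 18.2: a Noetherian ring is Cohen-Macaulay
   if depth(M, A) = codim M for every maximal ideal M.  For M maximal the depth
   of M on A is the depth of the local ring A_M, so this says that every A_M is
   a Cohen-Macaulay local ring. *)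
Definition cohen_macaulay : Prop :=
  noetherian /\
  forall M : {pred A}, maximal_ideal M ->
    exists d : nat, has_depth M d /\ has_codim M d.

End CohenMacaulay.

(* [symmetric] alone would refer to symmetric polynomials. *)
Section Graphs.
Variable n : nat.
Implicit Types (e : rel 'I_n) (S : {set 'I_n}).

Definition connected_graph e : Prop := forall i j : 'I_n, connect e i j.

Definition complete_graph e : Prop := forall i j : 'I_n, i != j -> e i j.

(* As a relation on the whole of 'I_n this isolates the vertices of S, which
   [ncomp_del] therefore has to discard. *)
Definition del_rel e S : rel 'I_n :=
  [rel i j | [&& i \notin S, j \notin S & e i j]].

Definition ncomp_del e S : nat := n_comp (del_rel e S) (~: S).

Definition tough e (t : rat) : Prop :=
  forall S, S != set0 -> (2 <= ncomp_del e S)%N ->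
    t * (ncomp_del e S)%:R <= #|S|%:R.

(* Minimum in the extended rationals; it is +oo when no S disconnects the graph,
   that is, for complete graphs.  See [tough_le_toughness] for toughness as the
   largest t such that the graph is t-tough. *)
Definition toughness e : \bar rat :=
  \big[mine/+oo%E]_(S : {set 'I_n} | (2 <= ncomp_del e S)%N)
     (#|S|%:R / (ncomp_del e S)%:R)%:E.

Lemma ncomp_del0 e : ssrbool.symmetric e -> connected_graph e -> (ncomp_del e set0 <= 1)%N.
Proof.
move=> es ec; rewrite /ncomp_del leqNgt; apply/negP => /card_gt1P[x [y []]].
move=> /andP[/= /eqP rx _] /andP[/= /eqP ry _]; rewrite -rx -ry => /eqP; apply.
have E : del_rel e set0 =2 e by move=> i j; rewrite /del_rel /= !in_set0.
apply/fingraph.rootP; first by apply: sym_connect_sym => i j; rewrite !E es.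
by rewrite (eq_connect E).
Qed.

Lemma tough_le_toughness e (t : rat) : ssrbool.symmetric e -> connected_graph e ->
  tough e t <-> (t%:E <= toughness e)%E.
Proof.
move=> es ec; rewrite /toughness; split=> [H|/bigmin_geP[_ H] S _ hS].
  apply/bigmin_geP; split=> [|S hS]; first exact: leey.
  have S0 : S != set0.
    by apply: contraTneq hS => ->; rewrite -leqNgt ncomp_del0.
  by rewrite lee_fin ler_pdivlMr ?ltr0n ?(ltnW hS)// H.
by move: (H S hS); rewrite lee_fin ler_pdivlMr ?ltr0n ?(ltnW hS).
Qed.

Lemma toughness_complete e : complete_graph e -> toughness e = +oo%E.
Proof.
move=> ec; rewrite /toughness big_pred0 // => S; apply/negbTE.
apply/negP => /card_gt1P[x [y]].
move=> [/andP[/= /eqP rx xS] /andP[/= /eqP ry yS] xy].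
have es : connect_sym (del_rel e S).
  apply: sym_connect_sym => i j; rewrite /del_rel /=.
  case: (eqVneq i j) => [->//|ij].
  by rewrite (ec i j ij) (ec j i) 1?eq_sym// !andbT andbC.
move: xy; rewrite -{1}rx -ry => /eqP; apply; apply/fingraph.rootP => //.
case: (eqVneq x y) => [->//|xy]; apply: connect1.
by rewrite !inE in xS yS; rewrite /del_rel /= xS yS ec.
Qed.

End Graphs.

Section BinomialEdgeIdeal.
Variables (K : fieldType) (n : nat).

Definition var_x (i : 'I_n) : {mpoly K[n + n]} := 'X_(lshift n i).
Definition var_y (i : 'I_n) : {mpoly K[n + n]} := 'X_(rshift n i).

Variable e : rel 'I_n.

(* Each edge {i, j} contributes the generator of (i, j) and its opposite. *)
Definition edge_binomials : seq {mpoly K[n + n]} :=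
  [seq var_x p.1 * var_y p.2 - var_x p.2 * var_y p.1
     | p in [pred p : 'I_n * 'I_n | e p.1 p.2]].

Definition binomial_edge_ideal : {mpoly K[n + n]} -> bool :=
  ideal_gen edge_binomials.

Lemma binomial_edge_ideal_closed : idealr_closed binomial_edge_ideal.
Proof.
split.
- by apply/asboolP; exists (fun=> 0); rewrite big1 // => i _; rewrite mul0r.
- apply/negP => /asboolP[c /(congr1 (meval (fun=> 0)))].
  rewrite rmorph1 rmorph_sum big1 => [/eqP|/= i _]; first by rewrite oner_eq0.
  rewrite rmorphM /=.
  have : edge_binomials`_i \in edge_binomials by rewrite mem_nth.
  move=> /imageP[p _ ->]; rewrite rmorphB !rmorphM /= !mevalXU.
  by rewrite !mulr0 subr0 mulr0.
- move=> a u v /asboolP[c ->] /asboolP[d ->]; apply/asboolP.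
  exists (fun i => a * c i + d i); rewrite mulr_sumr -big_split /=.
  by apply: eq_bigr => i _; rewrite mulrDl mulrA.
Qed.

HB.instance Definition _ :=
  isIdealr.Build {mpoly K[n + n]} binomial_edge_ideal binomial_edge_ideal_closed.

Definition binomial_edge_ring : comNzRingType :=
  {ideal_quot (binomial_edge_ideal : idealr {mpoly K[n + n]})}.

End BinomialEdgeIdeal.

(* Main.v *)
(** Let A = R/J_G, M = (x, y), and let P be the ideal of A generated by all
    2-minors x_i y_j - x_j y_i.  If A is Cohen-Macaulay then depth and height of
    M agree; call d the common value.

    A monomial containing every inner vertex of a path from i to j multiplies
    the (i, j) minor into J_G.  As G is connected, the product z of all x_i thus
    kills P.  R modulo the 2-minors embeds into K[t_1, ..., t_n, v], so among the
    monomials in n+2 elements of M there is a linear relation with values in P.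
    For a regular sequence the relation is, by a Kronecker substitution, a
    nonzerodivisor at M, although it kills z: hence d <= n + 1.  Chains of primes
    through the minimal primes attached to S give d >= n - |S| + c(S), so that
    c(S) <= |S| + 1 for all S, and tau(G) >= 1/2.

    A cut vertex v has c({v}) = 2, which gives equality.  If there is none, every
    monomial missing at most one vertex kills P, so P + ann P is so large that
    the same relation argument finds a regular sequence of length two in it.
    Hartshorne's connectedness argument then gives P = 0 or ann P = 0 at M; but z
    is a nonzero element of the latter, and P = 0 at M only when G is complete. *)
From HB Require Import structures.
Require Import Defs.
From mathcomp Require Import all_boot all_order all_algebra.
From mathcomp Require Import generic_quotient ring_quotient.
From mathcomp Require Import mpoly.
From mathcomp Require Import boolp constructive_ereal.
From mathcomp Require Import ring zify.

Set Implicit Arguments.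
Unset Strict Implicit.
Unset Printing Implicit Defensive.

Import Order.TTheory GRing.Theory Num.Theory.
Local Open Scope ring_scope.

(** * Finitely generated ideals *)

Section IdealGen.
Variable A : comNzRingType.

Lemma ideal_gen_lin (s : seq A) a x y :
  x \in ideal_gen s -> y \in ideal_gen s -> a * x + y \in ideal_gen s.
Proof.
move=> /asboolP[c ->] /asboolP[d ->]; apply/asboolP.
exists (fun i => a * c i + d i); rewrite mulr_sumr -big_split /=.
by apply: eq_bigr => i _; rewrite mulrDl mulrA.
Qed.

Lemma ideal_gen0 (s : seq A) : 0 \in ideal_gen s.
Proof. by apply/asboolP; exists (fun=> 0); rewrite big1 // => i _; rewrite mul0r. Qed.

Lemma ideal_genD (s : seq A) x y :
  x \in ideal_gen s -> y \in ideal_gen s -> x + y \in ideal_gen s.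
Proof. by move=> hx hy; rewrite -[x]mul1r ideal_gen_lin. Qed.

Lemma ideal_genM (s : seq A) a x :
  x \in ideal_gen s -> a * x \in ideal_gen s.
Proof. by move=> hx; rewrite -[_ * _]addr0 ideal_gen_lin ?ideal_gen0. Qed.

Lemma ideal_gen_sum (s : seq A) (J : Type) (r : seq J) (Q : pred J) (F : J -> A) :
  (forall i, Q i -> F i \in ideal_gen s) -> \sum_(i <- r | Q i) F i \in ideal_gen s.
Proof.
move=> h; apply: (big_ind (fun x => x \in ideal_gen s)) => //; first exact: ideal_gen0.
by move=> x y; apply: ideal_genD.
Qed.

Lemma mem_ideal_gen (s : seq A) x : x \in s -> x \in ideal_gen s.
Proof.
move=> xs; have xi : (index x s < size s)%N by rewrite index_mem.
apply/asboolP; exists (fun i => (i == Ordinal xi)%:R).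
rewrite (bigD1 (Ordinal xi)) //= eqxx mul1r nth_index // big1 ?addr0 // => i /negbTE->.
by rewrite mul0r.
Qed.

Lemma ideal_gen_min (s : seq A) (L : A -> Prop) :
  L 0 -> (forall a x y, L x -> L y -> L (a * x + y)) ->
  (forall x, x \in s -> L x) -> forall x, x \in ideal_gen s -> L x.
Proof.
move=> L0 Ll Ls x /asboolP[c ->].
by apply: (big_ind L) => // [u v Lu Lv|i _]; [rewrite -[u]mul1r|rewrite -[X in L X]addr0];
  apply: Ll => //; apply: Ls; rewrite mem_nth.
Qed.

(** [noetherian] covers proper ideals only, so the unit ideal is given the generator 1
    separately. *)
Lemma noetherian_fg (I : A -> Prop) : noetherian A ->
  I 0 -> (forall a x y, I x -> I y -> I (a * x + y)) ->
  exists l : seq A, forall x, I x <-> x \in ideal_gen l.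
Proof.
move=> nA I0 Il; have [I1|nI1] := pselect (I 1).
  exists [:: 1] => x; split=> _; last by rewrite -[x]mulr1 -[X in I X]addr0; apply: Il.
  by apply/asboolP; exists (fun=> x); rewrite big_ord1 mulr1.
have [|l lE] := nA (fun x => `[< I x >]).
  split; [exact/asboolP|exact/asboolP|move=> a u v /asboolP Iu /asboolP Iv].
  by apply/asboolP; apply: Il.
exists l => x; rewrite -lE; split=> [/asboolP//|/asboolP//].
Qed.

End IdealGen.

(** * Regular sequences in a localization *)

(* Ideals of the localization at the prime M are represented by the ideals of A
   that are saturated with respect to the complement of M. *)
Section LocalRegularSequences.
Variables (A : comNzRingType) (M : {pred A}).
Hypotheses (nA : noetherian A) (pM : prime_ideal M).
Implicit Types (I L : A -> Prop) (a b x y : A) (s l : seq A).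

Let M0 : 0 \in M. Proof. by case: pM => -[]. Qed.
Let M1 : 1 \notin M. Proof. by case: pM => -[]. Qed.
Let Ml a x y : x \in M -> y \in M -> a * x + y \in M.
Proof. by case: pM => -[_ _ h] _; apply: h. Qed.
Let MM x y : x \notin M -> y \notin M -> x * y \notin M.
Proof.
move=> hx hy; case: pM => _ h; apply/negP => /h /orP[]; exact/negP.
Qed.
Let MB u x : u \notin M -> x \in M -> u - x \notin M.
Proof. by move=> hu hx; apply: contra hu => h; rewrite -(subrK x u) -[u - x]mul1r Ml. Qed.

Definition sat_ideal I : Prop :=
  [/\ I 0, forall a x y, I x -> I y -> I (a * x + y)
    & forall u x, u \notin M -> I (u * x) -> I x].

(* The ideal I + (a) of the localization. *)
Definition adj I a : A -> Prop := fun x => exists u c, u \notin M /\ I (u * x - c * a).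

Lemma sat0 I : sat_ideal I -> I 0. Proof. by case. Qed.

Lemma satD I x y : sat_ideal I -> I x -> I y -> I (x + y).
Proof. by case=> _ h _ Ix Iy; rewrite -[x]mul1r; apply: h. Qed.

Lemma satMl I a x : sat_ideal I -> I x -> I (a * x).
Proof. by case=> I0 h _ Ix; rewrite -[_ * _]addr0; apply: h. Qed.

Lemma satN I x : sat_ideal I -> I x -> I (- x).
Proof. by move=> sI Ix; rewrite -mulN1r; apply: satMl. Qed.

Lemma satB I x y : sat_ideal I -> I x -> I y -> I (x - y).
Proof. by move=> sI Ix Iy; apply: satD => //; apply: satN. Qed.

Lemma sat_unit I u x : sat_ideal I -> u \notin M -> I (u * x) -> I x.
Proof. by case=> _ _ h; apply: h. Qed.

Lemma sat_sum I (J : Type) (r : seq J) (P : pred J) (F : J -> A) :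
  sat_ideal I -> (forall i, P i -> I (F i)) -> I (\sum_(i <- r | P i) F i).
Proof. by move=> sI h; apply: (big_ind I); [exact: sat0|move=> *; exact: satD|]. Qed.

Lemma adj_sat I a : sat_ideal I -> sat_ideal (adj I a).
Proof.
move=> sI; split.
- by exists 1, 0; split=> //; rewrite mul1r mul0r subr0; apply: sat0.
- move=> c x y [u [p [hu hx]]] [v [q [hv hy]]].
  exists (u * v), (v * c * p + u * q); split; first exact: MM.
  rewrite (_ : _ - _ = (v * c) * (u * x - p * a) + u * (v * y - q * a)); last by ring.
  by apply: satD => //; apply: satMl.
- move=> u x hu [v [c [hv h]]]; exists (v * u), c; split; first exact: MM.
  by rewrite -mulrA.
Qed.

Lemma adj_sub I a x : sat_ideal I -> I x -> adj I a x.
Proof. by move=> sI Ix; exists 1, 0; rewrite mul1r mul0r subr0. Qed.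

Lemma adj_id I a : sat_ideal I -> adj I a a.
Proof. by move=> sI; exists 1, 1; rewrite subrr; split=> //; apply: sat0. Qed.

Lemma adj_min I a L : sat_ideal L -> (forall x, I x -> L x) -> L a ->
  forall x, adj I a x -> L x.
Proof.
move=> sL IL La x [u [c [hu /IL h]]]; apply: (sat_unit sL hu).
by rewrite -(subrK (c * a) (u * x)); apply: satD => //; apply: satMl.
Qed.

Lemma adjC I a b : sat_ideal I -> adj (adj I a) b = adj (adj I b) a.
Proof.
move=> sI; apply/funext => x; apply/propext.
have h p q y : adj (adj I p) q y -> adj (adj I q) p y.
  have sq : sat_ideal (adj I q) by apply: adj_sat.
  have spq : sat_ideal (adj (adj I q) p) by apply: adj_sat.
  apply: adj_min => //; last by apply: adj_sub => //; apply: adj_id.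
  by apply: adj_min => //; [move=> z Iz; do 2!apply: adj_sub => //|apply: adj_id].
by split; apply: h.
Qed.

Lemma adj_congr I a b : sat_ideal I -> I (a - b) -> adj I a = adj I b.
Proof.
move=> sI h; apply/funext => x; apply/propext.
have k p q y : I (p - q) -> adj I p y -> adj I q y.
  have sq : sat_ideal (adj I q) by apply: adj_sat.
  move=> pq; apply: adj_min => //; first by move=> z; apply: adj_sub.
  by rewrite -(subrK q p); apply: satD; [|apply: adj_sub|apply: adj_id].
by split; apply: k => //; rewrite -opprB; apply: satN.
Qed.

Definition adjs I s := foldl adj I s.

Lemma adjs_sat I s : sat_ideal I -> sat_ideal (adjs I s).
Proof. by elim: s I => //= a s IH I sI; apply: IH; apply: adj_sat. Qed.

Lemma adjs_sub I s x : sat_ideal I -> I x -> adjs I s x.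
Proof.
by elim: s I => //= a s IH I sI Ix; apply: IH; [exact: adj_sat|exact: adj_sub].
Qed.

Lemma adjs_mem I s x : sat_ideal I -> x \in s -> adjs I s x.
Proof.
elim: s I => //= a s IH I sI; rewrite inE => /orP[/eqP->|xs]; last first.
  by apply: IH => //; apply: adj_sat.
by apply: adjs_sub; [apply: adj_sat|apply: adj_id].
Qed.

Lemma adjs_min I s L : sat_ideal L -> (forall x, I x -> L x) ->
  (forall x, x \in s -> L x) -> forall x, adjs I s x -> L x.
Proof.
move=> sL; elim: s I => //= a s IH I IL sLs; apply: IH; last first.
  by move=> x xs; apply: sLs; rewrite inE xs orbT.
by apply: adj_min => //; apply: sLs; rewrite inE eqxx.
Qed.

(** * Permutability of regular sequences *)

(** Generators are discarded one at a time: modulo [L] the last one satisfies [u * y = c * a * y],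
    and [u - c * a] lies outside [M], so [y] is already in [I] plus [a] times the others. *)
Lemma nakayama I a l : sat_ideal I -> a \in M ->
  (forall x, x \in l -> adjs I [seq a * y | y <- l] x) -> forall x, x \in l -> I x.
Proof.
move=> sI aM; elim/last_ind: l => [//|l y IH] h.
set L := adjs I [seq a * y | y <- l].
have sL : sat_ideal L by apply: adjs_sat.
have hE : adjs I [seq a * y | y <- rcons l y] = adj L (a * y).
  by rewrite map_rcons /adjs foldl_rcons.
have Ly : L y.
  have := h y; rewrite hE mem_rcons inE eqxx => /(_ isT)[u [c [hu k]]].
  apply: (sat_unit (u := u - c * a) sL); last by rewrite mulrBl -mulrA.
  by apply: MB => //; rewrite -[_ * _]addr0 Ml.
rewrite hE in h.
have hL x : x \in rcons l y -> L x.
  move=> /h; apply: adj_min => //; exact: satMl.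
have lI : forall x, x \in l -> I x.
  by apply: IH => x xl; apply: hL; rewrite mem_rcons inE xl orbT.
move=> x /hL; apply: adjs_min => // z /mapP[w wl ->]; apply: satMl => //; exact: lI.
Qed.

Definition nzd I a := forall x, I (a * x) -> I x.

Fixpoint reg I s : Prop :=
  if s is a :: s' then nzd I a /\ reg (adj I a) s' else True.

(** The hard half is that [b] is a nonzerodivisor modulo [I]. If [b * x] is in [I], then locally
    [x = a * c] modulo [I], and [b * c] is in [I] because [a] can be cancelled. So the colon ideal
    (I : b) lies in I + a (I : b), and Nakayama puts it inside [I]. *)
Lemma reg_swap I a b s : sat_ideal I -> a \in M -> 
  reg I [:: a, b & s] -> reg I [:: b, a & s].
Proof.
move=> sI aM /= [ha [hb hs]]; split; last first.
  split; last by rewrite adjC.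
  move=> x [u [c [hu h]]].
  have [|v [d [hv k]]] := hb c.
    exists 1, (u * x); split=> //; rewrite (_ : _ - _ = - (u * (a * x) - c * b)); last by ring.
    exact: satN.
  exists (v * u), d; split; first exact: MM.
  apply: ha; rewrite (_ : _ * _ = v * (u * (a * x) - c * b) + b * (v * c - d * a)); last by ring.
  by apply: satD => //; apply: satMl.
have [|c x y hx hy|l lE] := @noetherian_fg A (fun x => I (b * x)) nA.
- by rewrite mulr0; apply: sat0.
- by rewrite (_ : _ * _ = c * (b * x) + b * y); [apply: satD => //; apply: satMl|ring].
have lI : forall x, x \in l -> I x.
  apply: (nakayama sI aM) => x /mem_ideal_gen/lE bx.
  have [|u [c [hu h]]] := hb x; first by apply: adj_sub.
  have /lE/asboolP[d cE] : I (b * c).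
    apply: ha; rewrite (_ : _ * _ = u * (b * x) - b * (u * x - c * a)); last by ring.
    by apply: satB => //; apply: satMl.
  set L := adjs _ _; have sL : sat_ideal L by apply: adjs_sat.
  apply: (sat_unit sL hu); rewrite -(subrK (c * a) (u * x)).
  apply: satD => //; first by apply: adjs_sub.
  rewrite cE mulr_suml; apply: sat_sum => // i _; rewrite -mulrA; apply: satMl => //.
  by rewrite mulrC; apply: adjs_mem => //; apply: map_f; rewrite mem_nth.
move=> x /lE; apply: ideal_gen_min => //; first exact: sat0.
by move=> c y z Iy Iz; apply: satD => //; apply: satMl.
Qed.

Lemma reg_cons_rcons I a s : sat_ideal I -> a \in M -> {subset s <= M} ->
  reg I (a :: s) <-> reg I (rcons s a).
Proof.
elim: s I => [//|b s IH] I sI aM sM.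
have bM : b \in M by rewrite sM ?inE ?eqxx.
have {}sM : {subset s <= M} by move=> x xs; rewrite sM // inE xs orbT.
rewrite rcons_cons; split.
  by move=> /reg_swap -/(_ sI aM)[hb]; rewrite -/reg => h; split=> //; apply/IH=> //; apply: adj_sat.
by move=> [hb h]; apply: reg_swap => //; split=> //; apply/IH => //; apply: adj_sat.
Qed.

Lemma reg_rcons I a s : reg I (rcons s a) <-> reg I s /\ nzd (adjs I s) a.
Proof. by elim: s I => [|b s IH] I /=; [tauto|rewrite IH; tauto]. Qed.

Lemma reg_congr I s s' : sat_ideal I -> size s = size s' ->
  (forall i, (i < size s)%N -> I (s`_i - s'`_i)) -> reg I s -> reg I s'.
Proof.
elim: s s' I => [|a s IH] [|b s'] I //= sI [ss] h [ha hs].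
have ab : I (a - b) by apply: (h 0%N).
rewrite -(adj_congr sI ab); split.
  move=> x hx; apply: ha; rewrite -(subrK b a) mulrDl; apply: satD => //.
  by rewrite mulrC; apply: satMl.
apply: IH hs => //; first exact: adj_sat.
by move=> i hi; apply: adj_sub => //; apply: (h i.+1).
Qed.

(** * Kronecker substitution *)

(** The exponents are the base [N] digits of [j], lowest first; [j < N ^ size s] enumerates the
    monomials with all exponents below [N]. *)
Fixpoint digit_mon (N : nat) s (j : nat) : A :=
  if s is a :: s' then a ^+ (j %% N) * digit_mon N s' (j %/ N) else 1.

(** Modulo these elements, with [k = 1], the monomial [digit_mon N (b :: s) j] becomes [b ^+ j] for
    [j] in the above range. *)
Fixpoint kron (N k : nat) b s : seq A :=
  if s is a :: s' then (a - b ^+ (N ^ k)) :: kron N k.+1 b s' else [::].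

Lemma size_kron N k b s : size (kron N k b s) = size s.
Proof. by elim: s k => //= a s IH k; rewrite IH. Qed.

Lemma nth_kron N k b s i : (i < size s)%N -> (kron N k b s)`_i = s`_i - b ^+ (N ^ (k + i)).
Proof.
elim: s k i => //= a s IH k [|i] hi /=; first by rewrite addn0.
by rewrite IH // addSnnS.
Qed.

Lemma kron_sub N k b s : (0 < N)%N -> b \in M -> {subset s <= M} ->
  {subset kron N k b s <= M}.
Proof.
move=> N0 bM sM x /(nthP 0)[i]; rewrite size_kron => hi <-; rewrite nth_kron //.
rewrite addrC -mulN1r; apply: Ml; last by apply: sM; rewrite mem_nth.
by rewrite -(prednK (n := N ^ _)%N) ?expn_gt0 ?N0 // exprSr -[_ * _]addr0; apply: Ml.
Qed.

Lemma satM_congr L x x' y y' : sat_ideal L -> L (x - x') -> L (y - y') -> L (x * y - x' * y').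
Proof.
move=> sL hx hy; rewrite (_ : _ - _ = y * (x - x') + x' * (y - y')); last by ring.
by apply: satD => //; apply: satMl.
Qed.

Lemma satX_congr L x y k : sat_ideal L -> L (x - y) -> L (x ^+ k - y ^+ k).
Proof.
move=> sL h; elim: k => [|k IH]; first by rewrite subrr; apply: sat0.
by rewrite !exprS; apply: satM_congr.
Qed.

Lemma digit_mon_congr L N k b s j : sat_ideal L -> (0 < N)%N -> (j < N ^ size s)%N ->
  (forall x, x \in kron N k b s -> L x) -> L (digit_mon N s j - b ^+ (N ^ k * j)).
Proof.
move=> sL N0; elim: s k j => [|a s IH] k j /=.
  by rewrite ltnS leqn0 => /eqP-> _; rewrite muln0 subrr; apply: sat0.
move=> hj h.
have -> : (N ^ k * j = N ^ k * (j %% N) + N ^ k * (N * (j %/ N)))%N.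
  by rewrite -mulnDr (mulnC N) addnC -divn_eq.
rewrite exprD; apply: satM_congr => //.
  by rewrite exprM; apply: satX_congr => //; apply: h; rewrite inE eqxx.
rewrite mulnA -expnSr; apply: IH => //.
  by rewrite ltn_divLR // -expnSr.
by move=> x hx; apply: h; rewrite inE hx orbT.
Qed.

(* Modulo the other elements of the new sequence, the combination of monomials
   becomes the polynomial [\sum_j c j * b ^+ j], a unit times a power of b. *)
Lemma reg_kron I b s N (c : nat -> A) :
  sat_ideal I -> reg I (b :: s) -> {subset b :: s <= M} -> (0 < N)%N ->
  (forall j, c j = 0 \/ c j \notin M) ->
  (exists2 j, (j < N ^ (size s).+1)%N & c j != 0) ->
  \sum_(j < N ^ (size s).+1) c j * digit_mon N (b :: s) j \in M ->
  reg I ((\sum_(j < N ^ (size s).+1) c j * digit_mon N (b :: s) j) :: kron N 1 b s).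
Proof.
move=> sI hreg hM N0 hc hex FM.
have bM : b \in M by rewrite hM ?inE ?eqxx.
have sM : {subset s <= M} by move=> x xs; rewrite hM // inE xs orbT.
have kM : {subset kron N 1 b s <= M} by apply: kron_sub.
set F := \sum_(j < _) _ in FM *; set k := kron N 1 b s in kM *.
have digM j : (0 < j)%N -> b ^+ j \in M.
  by case: j => // j _; rewrite exprSr -[_ * _]addr0; apply: Ml.
have sL := adjs_sat k sI.
(* Modulo [b] the entries of [s] and of [k] agree, so [b :: k] is regular as well; then [b] moves to
   the end. *)
have hbk : reg I (rcons k b).
  apply/reg_cons_rcons => //; move: hreg => /= [hb hs]; split=> //.
  apply: reg_congr hs => //; [exact: adj_sat|by rewrite size_kron|move=> i hi].
  rewrite nth_kron // opprB addrC subrK add1n.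
  rewrite -(prednK (n := N ^ _)%N) ?expn_gt0 ?N0 // exprSr; apply: satMl.
    exact: adj_sat.
  exact: adj_id.
have [hk hb] := (reg_rcons I b k).1 hbk.
pose L := adjs I k.
have FL : L (F - \sum_(j < N ^ (size s).+1) c j * b ^+ j).
  rewrite /F -sumrB; apply: sat_sum => // j _; rewrite -mulrBr; apply: satMl => //.
  rewrite /= {3}(divn_eq j N) (addnC (_ * _)%N) exprD; apply: satM_congr => //.
    by rewrite subrr; apply: sat0.
  rewrite mulnC; have := @digit_mon_congr L N 1 b s (j %/ N); rewrite expn1; apply => //.
    by rewrite ltn_divLR // -expnSr.
  by move=> x; apply: adjs_mem.
(* The lowest nonzero coefficient: factoring out [b ^+ j0] leaves [c j0] plus a multiple of [b],
   which is outside [M]. *)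
have [j0 [hj0 cj0 jmin]] : exists j0, [/\ (j0 < N ^ (size s).+1)%N, c j0 != 0 &
   forall j, (j < j0)%N -> c j = 0].
  have ex : exists j, (j < N ^ (size s).+1)%N && (c j != 0).
    by case: hex => j h1 h2; exists j; rewrite h1.
  case: (ex_minnP ex) => j /andP[h1 h2] h3; exists j; split=> // i ij.
  apply/eqP; apply/negPn/negP => ci; have := h3 i; rewrite ci (ltn_trans ij h1) leqNgt ij.
  by move=> /(_ isT).
have [u [uM uE]] : exists u, u \notin M /\
    \sum_(j < N ^ (size s).+1) c j * b ^+ j = u * b ^+ j0.
  exists (c j0 - \sum_(j < N ^ (size s).+1 | (j0 < j)%N) - c j * b ^+ (j - j0)).
  split.
    apply: MB; first by case: (hc j0) cj0 => // ->; rewrite eqxx.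
    apply: (big_ind (fun x => x \in M)) => // [x y hx hy|j hj].
      by rewrite -[x]mul1r; apply: Ml.
    by rewrite -[_ * _]addr0; apply: Ml => //; apply: digM; rewrite subn_gt0.
  rewrite (bigID (fun j : 'I__ => (j0 < j)%N)) /=.
  rewrite [X in _ + X](bigD1 (Ordinal hj0)) /= ?ltnn //.
  rewrite [X in _ + (_ + X)]big1 ?addr0 => [|j /andP[h1 h2]]; last first.
    rewrite jmin ?mul0r // ltn_neqAle leqNgt h1 andbT.
    by apply: contra h2 => /eqP h; apply/eqP/val_inj.
  rewrite addrC mulrBl mulr_suml -sumrN; congr (_ + _); apply: eq_bigr => j hj.
  by rewrite !mulNr opprK -mulrA -exprD subnK // ltnW.
apply/reg_cons_rcons => //.
apply/reg_rcons; split=> // x hx.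
have {}hx : L (b ^+ j0 * x).
  apply: (sat_unit sL uM).
  rewrite mulrA -uE (_ : _ * x = F * x - x * (F - \sum_(j < N ^ (size s).+1) c j * b ^+ j)).
    by apply: satB => //; apply: satMl.
  by ring.
elim: j0 hx {hj0 cj0 jmin uE} => [|j IH]; first by rewrite mul1r.
by rewrite exprS -mulrA => /hb.
Qed.

Lemma reg_nth I s :
  (forall i, (i < size s)%N -> nzd (adjs I (take i s)) s`_i) -> reg I s.
Proof.
elim: s I => //= a s IH I h; split; first exact: (h 0%N).
by apply: IH => i hi; apply: (h i.+1).
Qed.

(** * Passage to the local ring, and connectedness *)

(** The kernel of the localization map at [M], hence the zero ideal of the local ring. *)
Definition loc0 x : Prop := exists2 u, u \notin M & u * x = 0.

Lemma loc_gen_sat s : sat_ideal (fun x => exists2 u, u \notin M & u * x \in ideal_gen s).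
Proof.
split.
- by exists 1 => //; rewrite mulr0; apply: ideal_gen0.
- move=> a x y [u hu hx] [v hv hy]; exists (u * v); first exact: MM.
  rewrite (_ : _ * _ = (v * a) * (u * x) + (u * (v * y) + 0)); last by ring.
  by do 2?apply: ideal_gen_lin => //; apply: ideal_gen0.
- by move=> u x hu [v hv h]; exists (v * u); [apply: MM|rewrite -mulrA].
Qed.

Lemma loc0_sat : sat_ideal loc0.
Proof.
split.
- by exists 1 => //; rewrite mulr0.
- move=> a x y [u hu hx] [v hv hy]; exists (u * v); first exact: MM.
  rewrite (_ : _ * _ = (v * a) * (u * x) + u * (v * y)); last by ring.
  by rewrite hx hy !mulr0 addr0.
- by move=> u x hu [v hv h]; exists (v * u); [apply: MM|rewrite -mulrA].
Qed.

(** A local relation for [x] becomes a relation in [A] after multiplication by some [u] outside [M];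
    regularity of [s] is then applied to [u * x]. *)
Lemma regular_seq_reg s : regular_seq s -> reg loc0 s.
Proof.
move=> [_ h]; apply: reg_nth => i hi x.
have sL := adjs_sat (take i s) loc0_sat.
move=> /(adjs_min (loc_gen_sat (take i s)))[||u hu].
- by move=> y [u hu uy]; exists u => //; rewrite uy ideal_gen0.
- by move=> y hy; exists 1 => //; rewrite mul1r mem_ideal_gen.
rewrite mulrCA => /(h _ hi) hx; apply: (sat_unit sL hu).
move: hx; apply: ideal_gen_min; first exact: sat0.
  by move=> a y z hy hz; apply: satD => //; apply: satMl.
by move=> y; apply: adjs_mem; apply: loc0_sat.
Qed.

(* Hartshorne's connectedness: [f1 + f2] and [h1 + h2] is a regular sequence in
   P + J with P J = 0.  It yields [a] with [f1 = a * (f1 + f2)] locally, and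
   [f1 * f2 = 0] makes [a] idempotent, hence 0 or 1. *)
Lemma connected_depth2 I (P J : A -> Prop) f1 f2 h1 h2 :
  sat_ideal I -> (forall p j, P p -> J j -> I (p * j)) ->
  P f1 -> P h1 -> J f2 -> J h2 -> f1 + f2 \in M -> reg I [:: f1 + f2; h1 + h2] ->
  (forall p, P p -> I p) \/ (forall j, J j -> I j).
Proof.
move=> sI PJ Pf Ph Jf Jh FM /= [hF [hH _]].
have [|u [a [hu h]]] := hH f1.
  exists 1, h1; split=> //.
  rewrite (_ : _ - _ = f1 * h2 - h1 * f2); last by ring.
  by apply: satB => //; apply: PJ.
have aI : I (a * (u - a)).
  apply: (hF); apply: (hF).
  rewrite (_ : _ * _ = (u * f1 - a * (f1 + f2)) * (a * (f1 + f2) - u * f2) +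
     u * u * (f1 * f2)); last by ring.
  by apply: satD => //; [rewrite mulrC|]; apply: satMl => //; apply: PJ.
(* One of [a] and [u - a] is outside [M], so the other vanishes modulo [I]. With [a] vanishes [f1],
   and then [f1 + f2] kills [P]; with [u - a] vanishes [f2], and then [f1 + f2] kills [J]. *)
case: (boolP (a \in M)) => aM.
  left=> p Pp.
  have {}aI : I a by apply: (sat_unit sI (MB hu aM)); rewrite mulrC.
  have f1I : I f1.
    by apply: (sat_unit sI hu); rewrite -(subrK (a * (f1 + f2)) (u * f1)); apply: satD;
       rewrite // mulrC; apply: satMl.
  by apply: (hF); rewrite mulrDl addrC (mulrC f2) (mulrC f1); apply: satD => //; [apply: PJ|apply: satMl].
right=> j Jj.
have {}aI : I (u - a) by apply: (sat_unit sI aM).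
have f2I : I f2.
  apply: (sat_unit sI hu).
  rewrite (_ : _ * _ = (f1 + f2) * (u - a) - (u * f1 - a * (f1 + f2))); last by ring.
  by apply: satB => //; apply: satMl.
by apply: (hF); rewrite mulrDl (mulrC f2); apply: satD => //; [apply: PJ|apply: satMl].
Qed.

End LocalRegularSequences.

(** * Linear relations among monomials *)

Lemma lin_relation (K : fieldType) (p : nat) (T : finType) (D : {set T}) (a : 'I_p -> T -> K) :
  (#|D| < p)%N ->
  exists2 c : 'I_p -> K, exists j, c j != 0 & {in D, forall t, \sum_j c j * a j t = 0}.
Proof.
move=> Dp; pose B : 'M[K]_(p, #|D|) := \matrix_(j, k) a j (enum_val k).
have /rowV0Pn[v] : kermx B != 0.
  by rewrite -mxrank_eq0 mxrank_ker subn_eq0 -ltnNge; apply: leq_ltn_trans (rank_leq_col _) Dp.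
move=> /sub_kermxP vB /rV0Pn[j vj]; exists (fun j => v 0 j); first by exists j.
move=> t tD; move/matrixP/(_ 0 (enum_rank_in tD t)): vB.
rewrite !mxE => vB; apply: etrans vB; apply: eq_bigr => i _.
by rewrite mxE enum_rankK_in.
Qed.

Section DigitMonomialDegree.
Variables (R : idomainType) (m : nat).
Implicit Types (p q : {mpoly R[m]}) (s : seq {mpoly R[m]}).

Lemma msizeM_bound p q a b :
  (msize p <= a.+1)%N -> (msize q <= b.+1)%N -> (msize (p * q) <= (a + b).+1)%N.
Proof.
move=> ha hb; have [->|p0] := eqVneq p 0; first by rewrite mul0r msize0.
have [->|q0] := eqVneq q 0; first by rewrite mulr0 msize0.
by rewrite msizeM //; move: (msize p) (msize q) ha hb => u v; lia.
Qed.

Lemma msizeX_bound p a k : (msize p <= a.+1)%N -> (msize (p ^+ k) <= (k * a).+1)%N.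
Proof.
move=> ha; elim: k => [|k IH]; first by rewrite expr0 msize1.
by rewrite exprS mulSn msizeM_bound.
Qed.

Lemma msize_digit_mon N s j a : (0 < N)%N ->
  {in s, forall p, (msize p <= a.+1)%N} -> (msize (digit_mon N s j) <= (size s * N * a).+1)%N.
Proof.
move=> N0; elim: s j => [|p s IH] j h /=; first by rewrite msize1.
rewrite !mulSn mulnDl; apply: msizeM_bound; last first.
  by apply: IH => q qs; apply: h; rewrite inE qs orbT.
apply: leq_trans (msizeX_bound _ (h p _)) _; first by rewrite inE eqxx.
by rewrite ltnS leq_mul2r (ltnW (ltn_pmod _ N0)) orbT.
Qed.

End DigitMonomialDegree.

Section Counting.
Variables (K : fieldType) (m : nat).

(* There are [N ^ size s] monomials in s, all of degree [O(N)], but only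
   [O(N ^ r)] linear conditions. *)
Lemma poly_relation (s : seq {mpoly K[m]}) (r C : nat) (T : nat -> finType)
    (D : forall B, {set T B}) (key : forall B, 'X_{1..m < B.+1} -> T B) :
  (r < size s)%N -> (forall B, #|D B| <= C * B.+1 ^ r)%N ->
  exists N B, exists c : nat -> K,
    [/\ (0 < N)%N, (exists2 j, (j < N ^ size s)%N & c j != 0),
        (msize (\sum_(j < N ^ size s) c j *: digit_mon N s j) <= B.+1)%N
      & forall k, k \in D B ->
          \sum_(w : 'X_{1..m < B.+1} | key B w == k)
             (\sum_(j < N ^ size s) c j *: digit_mon N s j)@_w = 0].
Proof.
(* [B] bounds all degrees and [B.+1 <= N * E], so there are at most [C * (N * E) ^ r] conditions;
   [N] exceeds [C * E ^ r], which keeps this below [N ^ r.+1]. *)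
move=> rs DC; pose a := \max_(p <- s) msize p; pose E := (size s * a).+1%N.
pose N := (C * E ^ r).+1; pose B := (size s * N * a)%N.
have N0 : (0 < N)%N by [].
have sz j : (msize (digit_mon N s j) <= B.+1)%N.
  by apply: msize_digit_mon => // p ps; rewrite leqW //; apply: leq_bigmax_seq.
have DN : (#|D B| < N ^ size s)%N.
  apply: leq_ltn_trans (DC B) _.
  have BE : (B.+1 <= N * E)%N by rewrite /B /E; nia.
  apply: (@leq_ltn_trans (C * (N * E) ^ r)%N).
    rewrite leq_mul2l; case: (r) => [|r']; rewrite ?expn0 ?orbT //.
    by rewrite leq_exp2r // BE orbT.
  apply: (@leq_trans (N ^ r.+1)%N); last by rewrite leq_pexp2l.
  by rewrite expnMn mulnCA expnSr ltn_pmul2l ?expn_gt0.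
have [c [j0 cj0] hc] := lin_relation (fun j k =>
  \sum_(w : 'X_{1..m < B.+1} | key B w == k) (digit_mon N s (nat_of_ord j))@_w) DN.
pose c' j := if insub j is Some i then c i else 0.
have c'E (j : 'I_(N ^ size s)) : c' j = c j by rewrite /c' valK.
exists N, B, c'; split=> //; first by exists j0 => //; rewrite c'E.
  apply: (big_ind (fun p => (msize p <= B.+1)%N)) => //; first by rewrite msize0.
    by move=> p q hp hq; apply: leq_trans (msizeD_le _ _) _; rewrite geq_max hp.
  by move=> j _; apply: leq_trans (msizeZ_le _ _) _.
move=> k kD; rewrite -[RHS](hc k kD).
under eq_bigr do rewrite raddf_sum /=.
rewrite exchange_big /=; apply: eq_bigr => j _; rewrite mulr_sumr c'E.
by apply: eq_bigr => w _; rewrite mcoeffZ.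
Qed.

End Counting.

(** * Monomials modulo the 2-minors *)

Section Words.
Variables (K : fieldType) (n : nat).
Implicit Types (i j k : 'I_n) (e : rel 'I_n) (w : seq ('I_n * bool)).

Definition letter (p : 'I_n * bool) : {mpoly K[n + n]} :=
  if p.2 then var_y K p.1 else var_x K p.1.

Definition wprod w : {mpoly K[n + n]} := \prod_(p <- w) letter p.

Definition minor i j : {mpoly K[n + n]} := var_x K i * var_y K j - var_x K j * var_y K i.

Definition minors : seq {mpoly K[n + n]} := edge_binomials K (fun _ _ : 'I_n => true).

Lemma minor_edge e i j : e i j -> minor i j \in edge_binomials K e.
Proof. by move=> h; apply/imageP; exists (i, j). Qed.

Lemma wprod_perm w w' : perm_eq w w' -> wprod w = wprod w'.
Proof. exact: perm_big. Qed.

Lemma wprod_cons p w : wprod (p :: w) = letter p * wprod w.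
Proof. exact: big_cons. Qed.

(** Exchanging the marks x and y between two letters costs a multiple of a minor. If the letter of
    [i] in [w'] has the wrong mark, equality of the counts provides some [j] in [w'] with the right
    one; after the exchange the first letter of [w] can be split off. *)
Lemma wprod_straight w w' :
  perm_eq (map fst w) (map fst w') -> count snd w = count snd w' ->
  wprod w - wprod w' \in ideal_gen minors.
Proof.
elim: w w' => [|[i b] r IH] w'.
  by move=> /perm_size; case: w' => // _ _; rewrite subrr ideal_gen0.
move=> hp hc.
have : i \in map fst w' by rewrite -(perm_mem hp) inE eqxx.
move=> /mapP[[i' b'] /= /perm_to_rem hw ii]; rewrite -{}ii in hw.
move: (rem _ _) hw => r' hw; rewrite (wprod_perm hw).
move: hp hc; rewrite (permPr (perm_map fst hw)) (permP hw) /= perm_cons => hp hc.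
case: (eqVneq b' b) => [bb|nbb].
  rewrite bb !wprod_cons -mulrBr; apply: ideal_genM; apply: IH => //.
  by move: hc; rewrite bb => /addnI.
have [j jr] : exists j, (j, b) \in r'.
  have : has (fun p : 'I_n * bool => p.2 == b) r'.
    rewrite has_count; move: hc nbb (count_predC snd r') (count_predC snd r).
    have -> : count (fun p : 'I_n * bool => p.2 == b) r' =
              if b then count snd r' else count (predC snd) r'.
      by case: b => //; apply: eq_count => -[? []].
    rewrite -(size_map fst r') -(perm_size hp) size_map.
    clear; case: b; case: b' => //=; lia.
  by move=> /hasP[[j b0] h /= /eqP b0b]; exists j; rewrite -b0b.
have := perm_to_rem jr; move: (rem _ _) => r2 hr'.
rewrite (@wprod_perm ((i, b') :: r') [:: (i, b'), (j, b) & r2]) ?perm_cons //.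
have sw : wprod [:: (i, b), (j, b') & r2] - wprod [:: (i, b'), (j, b) & r2] \in ideal_gen minors.
  rewrite !wprod_cons !mulrA -mulrBl mulrC; apply: ideal_genM.
  have h k l : minor k l \in ideal_gen minors by apply/mem_ideal_gen/minor_edge.
  rewrite /letter; clear -nbb h; case: b b' nbb => -[] //= _.
    by rewrite (mulrC (var_y K i)); apply: (h j i).
  by rewrite (mulrC (var_y K i)); apply: (h i j).
rewrite -(subrKA (wprod [:: (i, b), (j, b') & r2])); apply: ideal_genD => //.
rewrite !(wprod_cons (i, b)) -mulrBr; apply: ideal_genM; apply: IH.
  by rewrite (permPl hp) (perm_map fst hr').
by move: hc; rewrite (permP hr') /= addnCA => /addnI.
Qed.

Definition mono_word (m : 'X_{1..n + n}) : seq ('I_n * bool) :=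
  flatten [seq nseq (m (lshift n i)) (i, false) ++ nseq (m (rshift n i)) (i, true)
          | i <- index_enum 'I_n].

Lemma wprod_mono_word m : wprod (mono_word m) = 'X_[m].
Proof.
rewrite /wprod /mono_word big_flatten big_map mpolyXE_id big_split_ord /= -big_split /=.
by apply: eq_bigr => i _; rewrite big_cat !big_nseq /= -!Monoid.iteropE.
Qed.

Lemma size_mono_word m : size (mono_word m) = mdeg m.
Proof.
rewrite size_flatten sumnE /shape -map_comp big_map mdegE big_split_ord /= -big_split /=.
by apply: eq_bigr => i _; rewrite size_cat !size_nseq.
Qed.

(* The key encodes the image of the monomial under [x_i -> t_i], [y_i -> t_i v]. *)
Definition mono_key B (m : 'X_{1..(n + n) < B.+1}) : {ffun 'I_n -> 'I_B.+1} * 'I_B.+1 :=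
  ([ffun i => inord (count_mem i (map fst (mono_word m)))], inord (count snd (mono_word m))).

Lemma mono_key_straight B (m m' : 'X_{1..(n + n) < B.+1}) :
  mono_key m = mono_key m' -> 'X_[m] - 'X_[m'] \in ideal_gen minors.
Proof.
move=> [/ffunP h1 /(congr1 val) h2]; rewrite -!wprod_mono_word.
have cB a (k : 'X_{1..(n + n) < B.+1}) : (count a (mono_word k) < B.+1)%N.
  by apply: leq_ltn_trans (count_size _ _) _; rewrite size_mono_word bmdeg.
apply: wprod_straight; last by move: h2; rewrite /= !inordK.
apply/allP => i _ /=; move: (h1 i); rewrite !ffunE => /(congr1 val) /=.
by rewrite !count_map !inordK // => ->.
Qed.

End Words.

(** * Monomials that annihilate the 2-minors *)

Section MinorAnnihilator.
Variables (K : fieldType) (n : nat) (e : rel 'I_n).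
Implicit Types (i j k v : 'I_n) (w : seq ('I_n * bool)).

Notation JG := (ideal_gen (edge_binomials K e)).

(** Expansion of a 3 x 3 determinant with a repeated row. *)
Lemma letter_minor k b i j :
  letter K (k, b) * minor K i j = letter K (i, b) * minor K k j + letter K (j, b) * minor K i k.
Proof.
rewrite /letter /minor; case: b => /=; move: (var_x K) (var_y K) => x y;
  by rewrite !mulrBr !mulrA; move: (x i) (x j) (x k) (y i) (y j) (y k) => *; ring.
Qed.

(** The colon ideal of J_G by the 2-minors; its image in the quotient is ann P. *)
Definition kills_minors (f : {mpoly K[n + n]}) : Prop := forall i j, f * minor K i j \in JG.

Lemma kills_minors_gen f p : kills_minors f -> p \in ideal_gen (minors K n) -> p * f \in JG.
Proof.
move=> hf; apply: (ideal_gen_min (L := fun p => p * f \in JG)).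
- by rewrite mul0r ideal_gen0.
- by move=> a x y hx hy; rewrite mulrDl -mulrA ideal_gen_lin.
- by move=> x /imageP[[i j] _ ->]; rewrite mulrC; apply: hf.
Qed.

(** The letter of the first inner vertex [k] trades the minor (i, j) for the edge binomial (i, k)
    and the minor (k, j), whose path is shorter. As [q] has no repetition, each inner vertex has a
    letter of its own to spend. *)
Lemma wprod_path q i j w : path e i (rcons q j) -> uniq q -> {subset q <= map fst w} ->
  wprod K w * minor K i j \in JG.
Proof.
elim: q i w => [|k q IH] i w /=.
  by rewrite andbT => ij _ _; apply/ideal_genM/mem_ideal_gen/minor_edge.
move=> /andP[ik hp] /andP[kq uq] hs.
have /mapP[[k' b] /= /perm_to_rem hw kk] : k \in map fst w by rewrite hs ?inE ?eqxx.
rewrite -{}kk in hw; move: (rem _ _) hw => w' hw.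
rewrite (wprod_perm K hw) wprod_cons mulrAC letter_minor mulrDl; apply: ideal_genD.
  rewrite -mulrA; apply: ideal_genM; rewrite mulrC; apply: IH => // x xq.
  have := hs x; rewrite inE xq orbT => /(_ isT).
  rewrite (perm_mem (perm_map fst hw)) inE => /orP[/eqP xk|//].
  by move: kq; rewrite -[k]/(k, b).1 -xk xq.
by rewrite mulrAC; apply/ideal_genM/mem_ideal_gen/minor_edge.
Qed.

Lemma kills_minors_wprod w :
  (forall i j, i != j -> exists q, [/\ path e i (rcons q j), uniq q & {subset q <= map fst w}]) ->
  kills_minors (wprod K w).
Proof.
move=> h i j; have [->|ij] := eqVneq i j; first by rewrite /minor subrr mulr0 ideal_gen0.
by have [q [h1 h2 h3]] := h i j ij; apply: wprod_path h1 h2 h3.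
Qed.

(** The terms of [F] are grouped by key. In a class from [D] the coefficients add up to zero, so the
    class is a combination of differences of monomials with equal keys, which lie in the ideal of
    minors. The other classes form [f]. *)
Lemma minors_split B (D : {set {ffun 'I_n -> 'I_B.+1} * 'I_B.+1}) (F : {mpoly K[n + n]})
    (Q : {mpoly K[n + n]} -> Prop) :
  Q 0 -> (forall c x y, Q x -> Q y -> Q (c%:MP * x + y)) ->
  (msize F <= B.+1)%N ->
  (forall t, t \in D -> \sum_(m : 'X_{1..(n + n) < B.+1} | mono_key m == t) F@_m = 0) ->
  (forall m : 'X_{1..(n + n) < B.+1}, mono_key m \notin D -> Q 'X_[m]) ->
  exists p f, [/\ F = p + f, p \in ideal_gen (minors K n) & Q f].
Proof.
move=> Q0 Ql hF hD hk; rewrite (mpolywE hF).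
rewrite (partition_big (@mono_key n B) predT) //= (bigID [pred t | t \in D]) /=.
eexists; eexists; split; first by [].
  apply: ideal_gen_sum => t tD.
  case: (pickP (fun m : 'X_{1..(n + n) < B.+1} => mono_key m == t)) => [m0 /eqP m0k|nok].
    rewrite (eq_bigr (fun m : 'X_{1..(n + n) < B.+1} =>
      F@_m *: ('X_[m] - 'X_[m0]) + F@_m *: 'X_[m0])); last first.
      by move=> m _; rewrite -scalerDr subrK.
    rewrite big_split /= -scaler_suml hD // scale0r addr0; apply: ideal_gen_sum => m /eqP mk.
    by rewrite -mul_mpolyC; apply: ideal_genM; apply: mono_key_straight; rewrite mk.
  by rewrite big_pred0 ?ideal_gen0.
have QD x y : Q x -> Q y -> Q (x + y) by move=> hx; rewrite -[x]mul1r -mpolyC1; apply: Ql.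
apply: (big_ind Q) => // t tD; apply: (big_ind Q) => // m /eqP mk.
by rewrite -mul_mpolyC -[_ * _]addr0; apply: Ql => //; apply: hk; rewrite mk.
Qed.

Lemma kills_minors0 : kills_minors 0.
Proof. by move=> i j; rewrite mul0r ideal_gen0. Qed.

Lemma kills_minors_lin a x y : kills_minors x -> kills_minors y -> kills_minors (a * x + y).
Proof. by move=> hx hy i j; rewrite mulrDl -mulrA ideal_gen_lin. Qed.

Lemma connect_uniq_path (r : rel 'I_n) i j : connect r i j -> i != j ->
  exists q, path r i (rcons q j) /\ uniq (i :: rcons q j).
Proof.
move=> /connectP[p hp jl] ij; move: hp jl; case/shortenP=> p' hp' up' _.
case/lastP: p' hp' up' => [|q x] hp' up' jl; first by rewrite jl eqxx in ij.
by rewrite last_rcons in jl; exists q; rewrite jl.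
Qed.

Hypotheses (e_sym : ssrbool.symmetric e) (e_conn : connected_graph e).

Lemma kills_minors_full w : (forall v, v \in map fst w) -> kills_minors (wprod K w).
Proof.
move=> hw; apply: kills_minors_wprod => i j ij.
have [q [hq]] := connect_uniq_path (e_conn i j) ij.
by rewrite /= rcons_uniq => /and3P[_ _ uq]; exists q; split=> // x _; apply: hw.
Qed.

(** Paths between other vertices can avoid [v], and [v] as an endpoint needs no letter. *)
Lemma kills_minors_but v w :
  (forall i j, i != v -> j != v -> connect (del_rel e [set v]) i j) ->
  (forall u, u != v -> u \in map fst w) -> kills_minors (wprod K w).
Proof.
move=> hc hw; apply: kills_minors_wprod.
have base i j : i != v -> j != v -> i != j -> exists q,
  [/\ path e i (rcons q j), uniq (i :: rcons q j), {subset i :: q <= map fst w} & v \notin q].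
  move=> iv jv ij; have [q [hq uq]] := connect_uniq_path (hc i j iv jv) ij.
  have vq : v \notin q.
    apply/negP => vq; move: hq; rewrite -cats1 => hq.
    case/splitPr: vq hq => q1 q2; rewrite -catA cat_path /= => /and3P[_ /and3P[_]].
    by rewrite in_set1 eqxx.
  exists q; split=> //.
    by apply: sub_path hq => a b /and3P[].
  move=> x; rewrite inE => /orP[/eqP->|xq]; apply: hw => //.
  by apply: contraNneq vq => <-.
(* A path from [v] steps to a neighbour [k] and continues without [v]. Here [k] becomes an inner
   vertex, which is why [base] also records a letter for the starting point. *)
have bv j : j != v -> exists q, [/\ path e v (rcons q j), uniq q & {subset q <= map fst w}].
  move=> jv; have vj : v != j by rewrite eq_sym.
  have [q' [/= hq' uq']] := connect_uniq_path (e_conn v j) vj.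
  have [k vk kv] : exists2 k, e v k & k != v.
    case: q' hq' uq' => [|k q'] /= /andP[h _] /andP[]; last first.
      by rewrite inE negb_or => /andP[h' _]; exists k; rewrite // eq_sym.
    by exists j.
  have [kj|kj] := eqVneq k j; first by exists [::]; rewrite /= -kj vk.
  have [q [h1 h2 h3 h4]] := base k j kv jv kj.
  exists (k :: q); split=> //=; first by rewrite vk.
  by move: h2; rewrite /= rcons_uniq mem_rcons inE negb_or => /andP[/andP[_ ->] /andP[_ ->]].
move=> i j ij.
have [iv|iv] := eqVneq i v; first by rewrite iv in ij *; apply: bv; rewrite eq_sym.
have [jv|jv] := eqVneq j v; last first.
  have [q [h1 h2 h3 h4]] := base i j iv jv ij; exists q; split=> //.
    by move: h2; rewrite /= rcons_uniq => /and3P[].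
  by move=> x xq; apply: h3; rewrite inE xq orbT.
have [q [h1 h2 h3]] := bv i iv; exists (rev q); rewrite rev_uniq; split=> //.
  have := rev_path e v (rcons q i); rewrite last_rcons belast_rcons rev_cons jv => ->.
  by rewrite (eq_path (e' := e)) // => a b; rewrite e_sym.
by move=> x; rewrite mem_rev; apply: h3.
Qed.

End MinorAnnihilator.

(** * The quotient ring and substitutions *)

(** What follows uses the quotient only through a surjection with this kernel. *)
Lemma binomial_edge_ring_proj (K : fieldType) (n : nat) (e : rel 'I_n) :
  exists pi : {rmorphism {mpoly K[n + n]} -> binomial_edge_ring K e},
    (forall a, exists p, pi p = a) /\
    (forall p, pi p = 0 <-> p \in ideal_gen (edge_binomials K e)).
Proof.
pose I : idealr {mpoly K[n + n]} := @binomial_edge_ideal K n e.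
exists (\pi_({ideal_quot I})%qT : {rmorphism _ -> _}); split=> [a|p].
  by exists (repr a); apply: reprK.
have := Quotient.idealrBE I p 0; rewrite subr0 => h.
split=> [p0|pI]; first by rewrite -[_ \in _]/(p \in I) h p0 rmorph0.
by apply/eqP; move: h; rewrite rmorph0 => <-.
Qed.

Lemma mpoly_rmorph_ext (K C : comNzRingType) (m : nat) (f g : {rmorphism {mpoly K[m]} -> C}) :
  (forall c, f c%:MP = g c%:MP) -> (forall i, f 'X_i = g 'X_i) -> f =1 g.
Proof.
move=> hC hX p; rewrite [p]mpolyE !rmorph_sum; apply: eq_bigr => w _.
rewrite -mul_mpolyC !rmorphM hC mpolyXE_id !rmorph_prod; congr (_ * _).
by apply: eq_bigr => i _; rewrite !rmorphXn hX.
Qed.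

Section KillVariables.
Variables (K : fieldType) (m : nat).

(** The variables in [T] survive; the others are set to zero. *)
Definition kill (T : {set 'I_m}) (p : {mpoly K[m]}) : {mpoly K[m]} :=
  p \mPo [tuple if i \in T then 'X_i else 0 | i < m].

HB.instance Definition _ (T : {set 'I_m}) := GRing.RMorphism.copy (kill T)
  (comp_mpoly [tuple if i \in T then 'X_i else 0 | i < m]).

Lemma killC T c : kill T c%:MP = c%:MP. Proof. exact: comp_mpolyC. Qed.

Lemma killX T i : kill T 'X_i = if i \in T then 'X_i else 0.
Proof. by rewrite /kill comp_mpolyXU -tnth_nth tnth_mktuple. Qed.

Lemma kill_kill (T T' : {set 'I_m}) p : T \subset T' -> kill T (kill T' p) = kill T p.
Proof.
move=> /subsetP TT'.
have /= := @mpoly_rmorph_ext K {mpoly K[m]} m (kill T \o kill T') (kill T); apply=> [c|i] /=.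
  by rewrite !killC.
rewrite !killX; case: (boolP (i \in T')) => [_|iT']; first by rewrite killX.
by rewrite rmorph0 (negbTE (contra (TT' i) iT')).
Qed.

Lemma meval0_kill T p : (kill T p).@[fun=> 0] = p.@[fun=> 0].
Proof.
rewrite /kill comp_mpoly_meval; apply: meval_eq => i; rewrite tnth_mktuple.
by case: ifP => _; rewrite ?mevalXU ?meval0.
Qed.

End KillVariables.

(** * Primes of the quotient and the height of the origin *)

Section QuotientPrimes.
Variables (K : fieldType) (n : nat) (e : rel 'I_n) (A : comNzRingType).
Variable pi : {rmorphism {mpoly K[n + n]} -> A}.
Hypotheses (pi_surj : forall a, exists p, pi p = a)
  (pi_ker : forall p, pi p = 0 <-> p \in ideal_gen (edge_binomials K e)).

(** If [f] vanishes on the edge binomials, this is the kernel of the induced map from [A] to the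
    domain [C]. *)
Definition ker_quot (C : idomainType) (f : {rmorphism {mpoly K[n + n]} -> C}) : {pred A} :=
  fun a => `[< exists2 p, pi p = a & f p = 0 >].

Section Kernel.
Variables (C : idomainType) (f : {rmorphism {mpoly K[n + n]} -> C}).
Hypothesis f_edge : forall i j, e i j -> f (minor K i j) = 0.

Lemma rmorph_edge_ideal p : p \in ideal_gen (edge_binomials K e) -> f p = 0.
Proof.
apply: (ideal_gen_min (L := fun p => f p = 0)); first exact: rmorph0.
  by move=> a x y hx hy; rewrite rmorphD rmorphM hx hy mulr0 addr0.
by move=> x /imageP[[i j] /= ij ->]; apply: f_edge.
Qed.

Lemma mem_ker_quot p : (pi p \in ker_quot f) = (f p == 0).
Proof.
apply/idP/eqP => [/asboolP[q qp fq]|fp]; last by apply/asboolP; exists p.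
have : pi (p - q) = 0 by rewrite rmorphB qp subrr.
by move=> /pi_ker /rmorph_edge_ideal; rewrite rmorphB fq subr0.
Qed.

Lemma ker_quot_prime : prime_ideal (ker_quot f).
Proof.
split.
  split; [by rewrite -(rmorph0 pi) mem_ker_quot rmorph0| |].
    by rewrite -(rmorph1 pi) mem_ker_quot rmorph1 oner_eq0.
  move=> a u v; have [p <-] := pi_surj a; have [q <-] := pi_surj u; have [r <-] := pi_surj v.
  rewrite -rmorphM -rmorphD !mem_ker_quot rmorphD rmorphM => /eqP-> /eqP->.
  by rewrite mulr0 addr0.
move=> u v; have [p <-] := pi_surj u; have [q <-] := pi_surj v.
by rewrite -rmorphM !mem_ker_quot rmorphM mulf_eq0.
Qed.

End Kernel.

Definition origin_ideal : {pred A} := ker_quot (meval (fun=> 0)).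

Lemma meval0_minor (i j : 'I_n) : (minor K i j).@[fun=> 0] = 0.
Proof. by rewrite rmorphB !rmorphM /= !mevalXU !mulr0 subrr. Qed.

Lemma mem_origin_ideal p : (pi p \in origin_ideal) = (p.@[fun=> 0] == 0).
Proof. by apply: mem_ker_quot => i j _; apply: meval0_minor. Qed.

Lemma origin_ideal_prime : prime_ideal origin_ideal.
Proof. by apply: ker_quot_prime => i j _; apply: meval0_minor. Qed.

(** Every element is a constant modulo this ideal, so an ideal containing it and one more element
    contains a nonzero constant. *)
Lemma origin_ideal_maximal : maximal_ideal origin_ideal.
Proof.
split; first by case: origin_ideal_prime.
move=> I [I0 I1 IL] MI a aI; apply/negPn/negP => aM.
have [p pa] := pi_surj a; rewrite -pa mem_origin_ideal in aM.
set c := p.@[_] in aM.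
have : pi (p - c%:MP) \in I by apply: MI; rewrite mem_origin_ideal rmorphB /= mevalC subrr.
rewrite rmorphB pa => h; move: I1 => /negP; apply.
have /(IL (- 1) _ _ h) := aI; rewrite mulN1r opprB subrK => cI.
have := IL (pi (c^-1)%:MP) _ _ cI I0.
by rewrite addr0 -rmorphM -mpolyCM mulVf // rmorph1.
Qed.

Section Chain.
Variable S : {set 'I_n}.

Let root_of (i : 'I_n) : 'I_n := fingraph.root (del_rel e S) i.

(* The parametrization [x_i -> t_i], [y_i -> t_i v_c], with c the component of i. *)
Let para : (n + n).-tuple {mpoly K[n + n]} :=
  [tuple match split k with
         | inl i => 'X_k
         | inr i => 'X_(lshift n i) * 'X_(rshift n (root_of i))
         end | k < n + n].

Let psi (T : {set 'I_(n + n)}) : {rmorphism {mpoly K[n + n]} -> {mpoly K[n + n]}} :=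
  kill T \o comp_mpoly para.

Let psi_x T i : psi T (var_x K i) = if lshift n i \in T then 'X_(lshift n i) else 0.
Proof.
rewrite /= /comp /var_x comp_mpolyXU -tnth_nth tnth_mktuple.
by rewrite (unsplitK (inl i)) /= killX.
Qed.

Let psi_y T i : psi T (var_y K i) =
  if (lshift n i \in T) && (rshift n (root_of i) \in T)
  then 'X_(lshift n i) * 'X_(rshift n (root_of i)) else 0.
Proof.
rewrite /= /comp /var_y comp_mpolyXU -tnth_nth tnth_mktuple.
rewrite (unsplitK (inr i)) /= rmorphM /= !killX.
by case: ifP => _ /=; case: ifP => _; rewrite ?mul0r ?mulr0.
Qed.

(** The chain consists of the kernels of [psi (T k)], where [T k] holds the first [k] parameters. It
    starts at the origin, where all parameters are zero, and freeing one more parameter strictly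
    shrinks the kernel. *)
Lemma codim_origin_ge d : ssrbool.symmetric e -> has_codim origin_ideal d ->
  (n - #|S| + ncomp_del e S <= d)%N.
Proof.
move=> e_sym [_ hmax].
pose rts := [predI fingraph.roots (del_rel e S) & ~: S].
(* The t_i precede the v_c: the image of y_r contains t_r, which must be free already when v_r is
   added. *)
pose L := [seq lshift n i | i <- enum (~: S)] ++ [seq rshift n r | r <- enum rts].
have sL : size L = (n - #|S| + ncomp_del e S)%N.
  have := cardsC S; rewrite card_ord size_cat !size_map -!cardE => cS.
  by congr (_ + _)%N; rewrite -[X in (X - _)%N]cS addKn.
have uL : uniq L.
  rewrite cat_uniq !map_inj_uniq ?enum_uniq ?andbT //; first last.
  - exact: lshift_inj.
  - exact: rshift_inj.
  - by apply/hasPn => _ /mapP[r _ ->]; apply/mapP => -[i _ /eqP]; rewrite eq_rlshift.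
pose T k := [set x in take k L].
have psiS (i : 'I_n) k : i \in S -> lshift n i \notin T k.
  move=> iS; rewrite inE; apply/negP => /mem_take; rewrite mem_cat => /orP[] /mapP[r].
    by rewrite mem_enum inE => rS /lshift_inj ir; rewrite -ir iS in rS.
  by move=> _ /eqP; rewrite eq_lrshift.
have psiE k (i j : 'I_n) : e i j -> psi (T k) (minor K i j) = 0.
  move=> ij; rewrite /minor rmorphB !rmorphM !psi_x !psi_y.
  have [iS|iS] := boolP (i \in S); first by rewrite (negbTE (psiS i k iS)) /= !(mul0r, mulr0) subrr.
  have [jS|jS] := boolP (j \in S); first by rewrite (negbTE (psiS j k jS)) /= !(mul0r, mulr0) subrr.
  have -> : root_of i = root_of j.
    apply/fingraph.rootP; last by apply: connect1; rewrite /del_rel /= iS jS.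
    by apply: sym_connect_sym => a b; rewrite /del_rel /= e_sym andbCA.
  case: (lshift n i \in T k); case: (lshift n j \in T k);
    case: (rshift n (root_of j) \in T k) => /=; rewrite ?(mul0r, mulr0) ?subrr //.
  by rewrite !mulrA (mulrC 'X_(lshift n i)) subrr.
apply: (hmax _ (fun k => ker_quot (psi (T k)))); rewrite -sL; split.
- move=> a; have [p <-] := pi_surj a; rewrite mem_ker_quot ?mem_origin_ideal; last exact: psiE.
  have -> : psi (T 0%N) p = (p.@[fun=> 0])%:MP.
    pose g : {rmorphism {mpoly K[n + n]} -> {mpoly K[n + n]}} :=
      @mpolyC (n + n) K \o meval (fun=> 0).
    apply: (@mpoly_rmorph_ext _ _ _ (psi (T 0%N)) g) => [c|i].
      by rewrite /= /comp comp_mpolyC killC mevalC.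
    rewrite -[i]splitK; case: (split i) => j /=.
      by rewrite [LHS]psi_x mevalXU inE take0 in_nil.
    by rewrite [LHS]psi_y mevalXU !inE take0 in_nil.
  by rewrite mpolyC_eq0.
- by move=> k _; apply: ker_quot_prime; apply: psiE.
move=> k kL.
have [x0 _] : exists x0 : 'I_(n + n), x0 \in L.
  by case: (L) kL => // x0 L' _; exists x0; rewrite inE eqxx.
pose z := nth x0 L k.
have zL : z \in L by rewrite mem_nth.
have Tk1 x : (x \in T k.+1) = (x == z) || (x \in T k).
  by rewrite !inE (take_nth x0) // mem_rcons inE.
have zk : z \notin T k.
  rewrite inE; apply/negP => h; move: uL; rewrite -(cat_take_drop k L) (drop_nth x0) //.
  by rewrite cat_uniq /= [z \in _]h andbF.
(* The witness is x_i when t_i is added, and y_r when the parameter of the component with root r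
   is. *)
have [p pk pk1] : exists2 p, psi (T k) p = 0 & psi (T k.+1) p != 0.
  have X0 i : 'X_i != 0 :> {mpoly K[n + n]} by rewrite -msize_poly_eq0 msizeX.
  move: (zL); rewrite mem_cat => /orP[] /mapP[i iS zi].
    exists (var_x K i); first by rewrite psi_x -zi (negbTE zk).
    by rewrite psi_x Tk1 -zi eqxx X0.
  have [/eqP ri {}iS] : fingraph.root (del_rel e S) i == i /\ i \in ~: S.
    by move: iS; rewrite mem_enum => /andP[].
  have ik : lshift n i \in T k.
    rewrite inE take_cat; case: ltnP => hk; last by rewrite mem_cat map_f // mem_enum.
    have : z \in [seq lshift n i | i <- enum (~: S)] by rewrite /z nth_cat hk mem_nth.
    by rewrite zi => /mapP[j _ /eqP]; rewrite eq_rlshift.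
  exists (var_y K i); first by rewrite psi_y /root_of ri -zi (negbTE zk) andbF.
  by rewrite psi_y /root_of ri !Tk1 -zi eqxx ik orbT mulf_neq0 ?X0.
have psi_sub q : psi (T k.+1) q = 0 -> psi (T k) q = 0.
  rewrite /= /comp => h; rewrite -(@kill_kill _ _ (T k) (T k.+1)) ?h ?rmorph0 //.
  by apply/subsetP => x; rewrite Tk1 orbC => ->.
split.
  move=> a; have [q <-] := pi_surj a.
  rewrite !mem_ker_quot; [|exact: psiE|exact: psiE].
  by move=> /eqP/psi_sub->.
move=> /(_ (pi p)); rewrite !mem_ker_quot; [|exact: psiE|exact: psiE].
by rewrite pk eqxx (negbTE pk1) => /(_ isT).
Qed.

End Chain.

End QuotientPrimes.

Lemma rmorph_digit_mon (B A : comNzRingType) (f : {rmorphism B -> A}) N (s : seq B) j :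
  f (digit_mon N s j) = digit_mon N (map f s) j.
Proof. by elim: s j => [|a s IH] j /=; rewrite ?rmorph1 // rmorphM rmorphXn IH. Qed.

(** * Counting keys *)

Section KeyBounds.
Variables (n : nat).

Definition two_missing B : {set {ffun 'I_n -> 'I_B.+1} * 'I_B.+1} :=
  [set t : {ffun 'I_n -> 'I_B.+1} * 'I_B.+1 | [exists i, [exists j, [&& i != j, t.1 i == ord0 & t.1 j == ord0]]]].

(** For a fixed pair of absent vertices, n - 2 multiplicities and the number of y's remain free,
    which gives the exponent n - 1. *)
Lemma card_two_missing B : (1 < n)%N -> (#|two_missing B| <= n ^ 2 * B.+1 ^ n.-1)%N.
Proof.
move=> n1.
pose E (p : 'I_n * 'I_n) : {set {ffun 'I_n -> 'I_B.+1} * 'I_B.+1} :=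
  setX [set f | f \in family (fun k => if (k == p.1) || (k == p.2) then pred1 ord0 else predT)] setT.
have cE p : p.1 != p.2 -> #|E p| = (B.+1 ^ n.-1)%N.
  case: p => i j /= ij; rewrite cardsX cardsT card_ord cardsE card_family foldrE big_map.
  rewrite (eq_bigr (fun k : 'I_n => if k \in ~: [set i; j] then B.+1 else 1%N)); last first.
    by move=> k _; rewrite !inE; case: ifP => _; rewrite ?card1 // card_ord.
  rewrite -big_mkcond /= big_enum_cond /= prod_nat_const -expnSr; congr (_ ^ _)%N.
  have := cardsC [set i; j]; rewrite cards2 ij card_ord; move: #|_| => c; lia.
have sub : two_missing B \subset \bigcup_(p : 'I_n * 'I_n | p.1 != p.2) E p.
  apply/subsetP => t; rewrite inE => /existsP[i /existsP[j /and3P[ij ti tj]]].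
  apply/bigcupP; exists (i, j) => //; rewrite !inE andbT; apply/familyP => k /=.
  by case: ifP => // /orP[] /eqP->; rewrite inE.
apply: leq_trans (subset_leq_card sub) _.
apply: (@leq_trans (\sum_(p : 'I_n * 'I_n | p.1 != p.2) B.+1 ^ n.-1)).
  apply: (big_ind2 (fun (X : {set _}) s => #|X| <= s)%N); first by rewrite cards0.
    by move=> X s Y t hX hY; apply: leq_trans (leq_card_setU _ _) _; apply: leq_add.
  by move=> p hp; rewrite cE.
by rewrite sum_nat_const leq_mul2r -mulnn -[X in (_ <= X * X)%N]card_ord -card_prod max_card orbT.
Qed.

Lemma two_missingPn B (m : 'X_{1..(n + n) < B.+1}) (i0 : 'I_n) :
  mono_key m \notin two_missing B ->
  exists v, forall u, u != v -> u \in map fst (mono_word m).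
Proof.
move=> hm.
have count0 u : u \notin map fst (mono_word m) -> (mono_key m).1 u == ord0.
  move=> /count_memPn h; rewrite ffunE h; apply/eqP/val_inj; by rewrite /= inordK.
case: (pickP (fun v => v \notin map fst (mono_word m))) => [v hv|h]; last first.
  by exists i0 => u _; move: (h u) => /negbFE.
exists v => u uv; apply/negPn/negP => hu; move: hm; rewrite inE => /existsP; apply.
by exists u; apply/existsP; exists v; rewrite uv !count0.
Qed.

End KeyBounds.

(** * Depth at the origin *)

Section LocalDepth.
Variables (K : fieldType) (n : nat) (e : rel 'I_n) (A : comNzRingType).
Variable pi : {rmorphism {mpoly K[n + n]} -> A}.
Hypotheses (e_sym : ssrbool.symmetric e) (e_conn : connected_graph e).
Hypotheses (pi_surj : forall a, exists p, pi p = a)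
  (pi_ker : forall p, pi p = 0 <-> p \in ideal_gen (edge_binomials K e)).
Hypothesis nA : noetherian A.

Let M := origin_ideal pi.
Let pM : prime_ideal M := origin_ideal_prime pi_surj pi_ker.
Let M_pi p : (pi p \in M) = (p.@[fun=> 0] == 0) := mem_origin_ideal pi_ker p.

(** The substitution factors through [A], has values in a domain and preserves constant terms, so no
    [u] outside [M] is sent to zero. *)
Lemma not_loc0 (T : {set 'I_(n + n)}) q :
  (forall i j, e i j -> kill T (minor K i j) = 0) -> kill T q != 0 -> ~ loc0 M (pi q).
Proof.
move=> hT hq [u hu]; have [p pu] := pi_surj u; rewrite -pu -rmorphM => /pi_ker.
move=> /(rmorph_edge_ideal (f := kill T) hT); rewrite rmorphM => /eqP.
rewrite mulf_eq0 (negbTE hq) orbF => /eqP h; move: hu.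
by rewrite -pu M_pi -(meval0_kill T) h rmorph0 eqxx.
Qed.

Let allx : seq ('I_n * bool) := [seq (i, false) | i <- enum 'I_n].

Lemma wprod_allx_not_loc0 : ~ loc0 M (pi (wprod K allx)).
Proof.
have h k : kill [set lshift n i | i : 'I_n] (var_y K k) = 0.
  rewrite killX; case: ifP => // /imsetP[j _ /eqP]; by rewrite eq_rlshift.
apply: (@not_loc0 [set lshift n i | i : 'I_n]) => [i j _|].
  by rewrite rmorphB !rmorphM /= !h !mulr0 subrr.
rewrite /wprod rmorph_prod /= big_map prodf_seq_neq0; apply/allP => i _ /=.
by rewrite /letter /= killX imset_f // -msize_poly_eq0 msizeX.
Qed.

Lemma minor_not_loc0 i j : i != j -> ~~ e i j -> ~ loc0 M (pi (minor K i j)).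
Proof.
move=> ij nij.
(* With only x_i and y_j kept, the edge binomials vanish because (i, j) is no edge, while the minor
   becomes x_i y_j. *)
have kx k : kill [set lshift n i; rshift n j] (var_x K k) = if k == i then var_x K k else 0.
  by rewrite killX !inE (inj_eq (@lshift_inj _ _)) eq_lrshift orbF.
have ky k : kill [set lshift n i; rshift n j] (var_y K k) = if k == j then var_y K k else 0.
  by rewrite killX !inE (inj_eq (@rshift_inj _ _)) eq_rlshift.
apply: (@not_loc0 [set lshift n i; rshift n j]) => [k l kl|].
  rewrite rmorphB !rmorphM /= !kx !ky.
  have h a b : e a b -> (a == i) && (b == j) = false.
    by move=> ab; apply/negP => /andP[/eqP ai /eqP bj]; move: nij; rewrite -ai -bj ab.
  have := h _ _ kl; rewrite e_sym in kl; have := h _ _ kl.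
  by case: (k == i); case: (l == j); case: (l == i); case: (k == j) => //=; rewrite ?(mul0r, mulr0) subrr.
rewrite rmorphB !rmorphM /= !kx !ky !eqxx (negbTE ij) mulr0 subr0.
by rewrite mulf_neq0 // -msize_poly_eq0 msizeX.
Qed.

Lemma minors_origin p : p \in ideal_gen (minors K n) -> pi p \in M.
Proof.
move=> h; rewrite M_pi; apply/eqP; move: p h.
apply: (ideal_gen_min (L := fun p : {mpoly K[n + n]} => p.@[fun=> 0] = 0)).
- exact: rmorph0.
- by move=> a x y hx hy; rewrite rmorphD rmorphM /= hx hy mulr0 addr0.
- by move=> x /imageP[[i j] _ ->]; apply: meval0_minor.
Qed.

(** The relation among monomials in lifts of [b :: s] suppresses the keys in [D], leaving a part [f]
    in [Q] besides the minors. By the Kronecker substitution it can head a regular sequence of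
    unchanged length. A general [I] allows a second application modulo the first element. *)
Lemma reg_step (r C : nat) (D : forall B, {set {ffun 'I_n -> 'I_B.+1} * 'I_B.+1})
    (Q : {mpoly K[n + n]} -> Prop) I b s :
  Q 0 -> (forall c x y, Q x -> Q y -> Q (c%:MP * x + y)) ->
  (forall f, Q f -> pi f \in M) ->
  (forall B, #|D B| <= C * B.+1 ^ r)%N -> (r <= size s)%N ->
  (forall B (m : 'X_{1..(n + n) < B.+1}), mono_key m \notin D B -> Q 'X_[m]) ->
  sat_ideal M I -> reg M I (b :: s) -> {subset b :: s <= M} ->
  exists p f t, [/\ p \in ideal_gen (minors K n), Q f, reg M I (pi p + pi f :: t),
                    {subset t <= M} & size t = size s].
Proof.
move=> Q0 Ql QM hD rs hQ sI hreg hM.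
have [l lE] : exists l, map pi l = b :: s.
  elim: (b :: s) => [|x u [l lE]]; first by exists [::].
  by have [p px] := pi_surj x; exists (p :: l); rewrite /= px lE.
have sl : size l = (size s).+1 by rewrite -(size_map pi) lE.
have rl : (r < size l)%N by rewrite sl.
have [N [B [c [N0 hc hF hFD]]]] := poly_relation (fun B => @mono_key n B) rl hD.
set F := \sum_(j < _) _ in hF hFD.
have [p [f [FE hp hf]]] := minors_split Q0 Ql hF hFD (hQ B).
have piF : pi F = \sum_(j < N ^ (size s).+1) pi (c j)%:MP * digit_mon N (b :: s) j.
  rewrite /F rmorph_sum sl; apply: eq_bigr => j _.
  by rewrite -mul_mpolyC rmorphM rmorph_digit_mon lE.
have FM : pi F \in M.
  case: pM => -[_ _ h] _; rewrite FE rmorphD -[pi p]mul1r; apply: h; last exact: QM.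
  exact: minors_origin.
have cM j : c j != 0 -> pi (c j)%:MP \notin M by rewrite M_pi /= mevalC.
have M0 : 0 \in M by case: pM => -[].
exists p, f, (kron N 1 b s); split=> //; last by rewrite size_kron.
  rewrite -rmorphD -FE piF.
  apply: (reg_kron (c := fun j => pi (c j)%:MP) nA pM) => //; last by rewrite -piF.
    move=> j; have [->|cj] := eqVneq (c j) 0; first by left; rewrite rmorph0.
    by right; apply: cM.
  case: hc => j hj cj; exists j; first by rewrite -sl.
  by apply: contraNneq (cM j cj) => ->.
apply: (kron_sub pM) => //; first by rewrite hM ?inE ?eqxx.
by move=> x xs; rewrite hM // inE xs orbT.
Qed.

Lemma mem_allx v : v \in map fst allx.
Proof.
by rewrite -map_comp (eq_map (g := id)) // map_id mem_enum.
Qed.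

Lemma pi_kills_minors p f :
  p \in ideal_gen (minors K n) -> kills_minors e f -> pi p * pi f = 0.
Proof. by move=> hp hf; rewrite -rmorphM; apply/pi_ker/kills_minors_gen. Qed.

(** With all keys suppressed, [f] is zero and a nonzerodivisor lies in P. The product of all x_i
    annihilates it without being locally zero. *)
Lemma depth_le d : has_depth M d -> (d <= n.+1)%N.
Proof.
move=> [[s [sreg sM sd]] _]; rewrite leqNgt; apply/negP; rewrite -sd => ns.
case: s sreg sM {sd} ns => // b s /(regular_seq_reg pM) sreg sM ns.
have Mz : pi 0 \in M by rewrite M_pi meval0.
have [|||||||||p [f [t [hp f0 [hz _] _ _]]]] := @reg_step n.+1 1 (fun B => setT) (fun f => f = 0)
  (loc0 M) b s.
- by [].
- by move=> c x y -> ->; rewrite mulr0 addr0.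
- by move=> f ->.
- by move=> B; rewrite cardsT card_prod card_ffun !card_ord mul1n expnSr.
- exact: ns.
- by move=> B m; rewrite inE.
- exact: loc0_sat.
- exact: sreg.
- exact: sM.
apply: wprod_allx_not_loc0; apply: hz; rewrite f0 rmorph0 addr0 pi_kills_minors //.
  by exists 1; [case: pM => -[]|rewrite mulr0].
by apply: kills_minors_full => // v; apply: mem_allx.
Qed.

(** Without a cut vertex only the keys in [two_missing] need suppressing. Their exponent n - 1 is
    two below that of all keys, and [n < d] leaves room for two applications of [reg_step]. *)
Lemma exists_cut_vertex d (i0 j0 : 'I_n) : i0 != j0 -> ~~ e i0 j0 ->
  has_depth M d -> (n < d)%N ->
  exists v i j, [/\ i != v, j != v & ~~ connect (del_rel e [set v]) i j].
Proof.
move=> ij0 nij0 [[s [sreg sM sd]] _] nd.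
have minor0 := minor_not_loc0 ij0 nij0.
have [//|ncut] := pselect (exists v i j, [/\ i != v, j != v & ~~ connect (del_rel e [set v]) i j]).
have {}ncut v i j : i != v -> j != v -> connect (del_rel e [set v]) i j.
  by move=> iv jv; apply/negPn/negP => nc; apply: ncut; exists v, i, j.
have n1 : (1 < n)%N.
  by have := max_card (mem [set i0; j0]); rewrite card_ord cards2 ij0.
(* Outside [M], [pi f] would make the minor (i0, j0) locally zero. *)
have QM f : kills_minors e f -> pi f \in M.
  move=> hf; apply/negPn/negP => fM; apply: minor0; exists (pi f) => //.
  by rewrite -rmorphM; apply/pi_ker; apply: hf.
have hQ B (m : 'X_{1..(n + n) < B.+1}) : mono_key m \notin two_missing n B -> kills_minors e 'X_[K, m].
  move=> /(two_missingPn i0)[v hv]; rewrite -wprod_mono_word.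
  by apply: (@kills_minors_but _ _ _ _ _ v) => // i j; apply: ncut.
have cardD B : (#|two_missing n B| <= n ^ 2 * B.+1 ^ n.-1)%N by apply: card_two_missing.
have Q0 := @kills_minors0 K n e.
have Ql (c : K) x y : kills_minors e x -> kills_minors e y -> kills_minors e (c%:MP * x + y).
  exact: kills_minors_lin.
case: s sreg sM sd => [_ _ /= d0|b s]; first by rewrite -d0 in nd.
move=> /(regular_seq_reg pM) sreg sM sd.
have sI := loc0_sat pM.
have ns : (n <= size s)%N by rewrite -sd in nd.
have [|p [f [t [hp hf [hr1 hr2] tM st]]]] := reg_step Q0 Ql QM cardD _ hQ sI sreg sM.
  by apply: leq_trans ns; apply: leq_pred.
case: t hr2 tM st => [_ _ st|b' t hr2 tM st].
  by move: ns; rewrite -st leqNgt (ltnW n1).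
have sF := adj_sat pM (pi p + pi f) sI.
(* [b' :: t] has at least n entries, so [t] still has the n - 1 that are required. *)
have [|p' [f' [t' [hp' hf' [hr3 _] _ _]]]] := reg_step Q0 Ql QM cardD _ hQ sF hr2 tM.
  by rewrite -ltnS -[(size t).+1]/(size (b' :: t)) st (leq_trans _ ns) // prednK // ltnW.
have FM : pi p + pi f \in M.
  by case: pM => -[_ _ h] _; rewrite -[pi p]mul1r; apply: h; [apply: minors_origin|apply: QM].
have [|||||||h|h] := @connected_depth2 A M pM (loc0 M)
  (fun a => exists2 q, pi q = a & q \in ideal_gen (minors K n))
  (fun a => exists2 q, pi q = a & kills_minors e q) (pi p) (pi f) (pi p') (pi f') sI.
- move=> _ _ [q <- hq] [g <- hg]; rewrite pi_kills_minors //; exact: sat0 sI.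
- by exists p.
- by exists p'.
- by exists f.
- by exists f'.
- exact: FM.
- by split=> //; split.
- case: minor0; apply: h; exists (minor K i0 j0) => //.
  exact/mem_ideal_gen/minor_edge.
case: wprod_allx_not_loc0; apply: h; exists (wprod K allx) => //.
by apply: kills_minors_full => // v; apply: mem_allx.
Qed.

End LocalDepth.

(** * Components after deletion of vertices *)

Section ComponentCount.
Variables (n : nat) (e : rel 'I_n) (S : {set 'I_n}).
Hypothesis e_sym : ssrbool.symmetric e.

Let del_sym : connect_sym (del_rel e S).
Proof. by apply: sym_connect_sym => a b; rewrite /del_rel /= e_sym andbCA. Qed.

Lemma root_del_rel i : i \notin S -> fingraph.root (del_rel e S) i \notin S.
Proof.
move=> iS; have cl : closed (del_rel e S) (~: S) by move=> a b /and3P[aS bS _]; rewrite !inE aS bS.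
by have := closed_connect cl (connect_root (del_rel e S) i); rewrite !inE iS => <-.
Qed.

Lemma ncomp_del_gt0 i : i \notin S -> (0 < ncomp_del e S)%N.
Proof.
move=> iS; apply/card_gt0P; exists (fingraph.root (del_rel e S) i).
by rewrite !inE (roots_root del_sym) root_del_rel.
Qed.

Lemma ncomp_del_gt1 i j : i \notin S -> j \notin S -> ~~ connect (del_rel e S) i j ->
  (1 < ncomp_del e S)%N.
Proof.
move=> iS jS nc; apply/card_gt1P.
exists (fingraph.root (del_rel e S) i), (fingraph.root (del_rel e S) j).
rewrite !inE !(roots_root del_sym) !root_del_rel //; split=> //.
by apply: contra nc => /eqP/(fingraph.rootP del_sym).
Qed.

End ComponentCount.

Theorem theorem1 (K : fieldType) (n : nat) (e : rel 'I_n)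
    (e_sym : ssrbool.symmetric e) (e_irr : irreflexive e) (e_conn : connected_graph e) :
  cohen_macaulay (binomial_edge_ring K e) ->
  toughness e = (1 / 2%:R : rat)%:E \/ complete_graph e.
Proof.
move=> [nA /= hCM].
have [pi [pi_surj pi_ker]] := binomial_edge_ring_proj K e.
have [d [hdepth hcodim]] := hCM _ (origin_ideal_maximal pi_surj pi_ker).
have [ec|nec] := pselect (complete_graph e); [by right|left].
have [i0 [j0 [ij0 nij0]]] : exists i j, i != j /\ ~~ e i j.
  apply: contrapT => h; apply: nec => i j ij; apply/negPn/negP => nij.
  by apply: h; exists i, j.
have cS (S : {set 'I_n}) := codim_origin_ge pi_surj pi_ker S e_sym hcodim.
have dn := depth_le e_conn pi_surj pi_ker nA hdepth.
(* The empty set has at least one component, so d is at least n + 1. *)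
have nd : (n < d)%N.
  have := cS set0; rewrite cards0 subn0; apply: leq_trans.
  by rewrite -addn1 leq_add2l (ncomp_del_gt0 e_sym (i := i0)) // in_set0.
have [v [i [j [iv jv nc]]]] := exists_cut_vertex e_sym e_conn pi_surj pi_ker nA ij0 nij0 hdepth nd.
(* From n - |S| + c(S) <= d <= n + 1; the bound |S| <= n makes the truncated subtraction exact. *)
have cle (S : {set 'I_n}) : (ncomp_del e S <= #|S|.+1)%N.
  have := leq_trans (cS S) dn; have := max_card (mem S); rewrite card_ord.
  move: #|_| (ncomp_del _ _) => a b; lia.
have c2 : ncomp_del e [set v] = 2%N.
  apply/eqP; rewrite eqn_leq (ncomp_del_gt1 e_sym _ _ nc) ?inE // andbT.
  by apply: leq_trans (cle _) _; rewrite cards1.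
apply/eqP; rewrite eq_le; apply/andP; split.
  rewrite /toughness; apply: le_trans (bigmin_le_cond _ (j := [set v]) _ _) _; first by rewrite c2.
  by rewrite c2 cards1.
apply/tough_le_toughness => // S S0 h2.
rewrite mul1r mulrC ler_pdivrMr ?ltr0n // -natrM ler_nat.
(* For nonempty S, c(S) <= |S| + 1 <= 2 |S|. *)
by move: S0 (cle S); rewrite -card_gt0; move: #|_| (ncomp_del _ _) => a b; lia.
Qed.
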